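(* Let $S\subseteq\mathbb{R}^d$ be nonempty, compact and convex, let $c$ be a random vector in $\mathbb{R}^d$ with $\mathbb{E}\|c\|<\infty$, let $\bar c := \mathbb{E}_c[c]$, and let $R_{\mathrm{SPO}}(\hat c) := \mathbb{E}_c[\ell_{\mathrm{SPO}}(\hat c,c)]$ for $\hat c\in\mathbb{R}^d$. If a cost vector $c^*\in\mathbb{R}^d$ is a minimizer of $R_{\mathrm{SPO}}(\cdot)$ over $\mathbb{R}^d$, then $W^*(c^* )\subseteq W^*(\bar c)$. Conversely, if $c^*\in\mathbb{R}^d$ is a cost vector such that $W^*(c^* )$ is a singleton and $W^*(c^* )\subseteq W^*(\bar c)$, then $c^*$ is a minimizer of $R_{\mathrm{SPO}}(\cdot)$.
   Context: For $c\in\mathbb{R}^d$: $z^*(c) := \min_{w\in S} c^Tw$ and $W^*(c) := \arg\min_{w\in S} c^Tw$. The (unambiguous) SPO loss is $\ell_{\mathrm{SPO}}(\hat c,c) := \max_{w\in W^*(\hat c)} c^Tw - z^*(c)$. *)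

(* Defs.v *)
(* Vectors of R^d are column vectors 'cV[R]_d over R : realType, with the
   library's product topology. *)
From mathcomp Require Import all_boot all_order all_algebra.
From mathcomp Require Import all_classical all_reals all_analysis.

Set Implicit Arguments.
Unset Strict Implicit.
Unset Printing Implicit Defensive.

Import Order.TTheory GRing.Theory Num.Theory.
Import numFieldNormedType.Exports.

Local Open Scope classical_set_scope.
Local Open Scope ring_scope.

Section spo.
Context {R : realType} {d : nat}.
Implicit Types (S : set 'cV[R]_d) (c w : 'cV[R]_d).

Definition dot c w : R := (c^T *m w) 0 0.

(* The norm the library puts on matrices is the sup norm. *)
Definition euclidean_norm c : R := Num.sqrt (dot c c).

(* For S nonempty and compact the infimum below is attained: see argmin_cost_neq0
   and argmin_costP. *)
Definition opt_cost S c : R := inf [set dot c w | w in S].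

Definition argmin_cost S c : set 'cV[R]_d :=
  [set w | S w /\ forall v, S v -> dot c w <= dot c v].

(* For S nonempty and compact, argmin_cost S chat is again nonempty and compact,
   so the supremum below is a maximum: see worst_cost_attained. *)
Definition spo_loss S (chat c : 'cV[R]_d) : R :=
  sup [set dot c w | w in argmin_cost S chat] - opt_cost S c.

End spo.

(* The Borel sigma-algebra of R^d is the one generated by the open sets. *)
Definition random_vector {R : realType} {d : nat} {disp : measure_display}
    {T : measurableType disp} (c : T -> 'cV[R]_d) : Prop :=
  measurable_fun setT (c : T -> g_sigma_algebraType (@open 'cV[R]_d)).

Section risk.
Context {R : realType} {d : nat} {disp : measure_display}
  {T : measurableType disp}.
Implicit Types (P : probability T R) (c : T -> 'cV[R]_d).

Definition mean_vector P c : 'cV[R]_d :=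
  \col_i fine ('E_P[fun t => (c t i 0)%R])%E.

Definition spo_risk P c (S : set 'cV[R]_d) (chat : 'cV[R]_d) : \bar R :=
  ('E_P[fun t => spo_loss S chat (c t)])%E.

Definition spo_risk_minimizer P c (S : set 'cV[R]_d) (cstar : 'cV[R]_d) : Prop :=
  forall chat : 'cV[R]_d, (spo_risk P c S cstar <= spo_risk P c S chat)%E.

End risk.

Section attained.
Context {R : realType} {d : nat}.
Implicit Types (S : set 'cV[R]_d) (c w chat : 'cV[R]_d).

Lemma dotE c w : dot c w = \sum_i c i 0 * w i 0.
Proof. by rewrite /dot mxE; apply: eq_bigr => i _; rewrite mxE. Qed.

Lemma continuous_dot c : continuous (dot c).
Proof.
rewrite (_ : dot c = fun w => \sum_i c i 0 * w i 0); last first.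
  by apply/funext => w; rewrite dotE.
have cc i : continuous (fun w : 'cV[R]_d => c i 0 * w i 0).
  move=> w; apply: (@continuous_comp _ _ _ (fun v : 'cV[R]_d => v i 0)).
    exact: coord_continuous.
  exact: mulrl_continuous.
by apply: continuous_big => [|i _]; [exact: add_continuous|exact: cc].
Qed.

Lemma argmin_cost_neq0 S c : S !=set0 -> compact S -> argmin_cost S c !=set0.
Proof.
move=> S0 cS; have [|w] := @compact_EVT_min _ _ (dot c) S S0 cS.
  exact/continuous_subspaceT/continuous_dot.
rewrite inE => Sw wmin; exists w; split=> // v Sv; apply: wmin.
by rewrite inE.
Qed.

Lemma argmin_costP S c w : argmin_cost S c w -> dot c w = opt_cost S c.
Proof.
move=> [Sw wmin]; apply/eqP; rewrite eq_le; apply/andP; split.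
  by apply: lb_le_inf => [|_ [v Sv <-]]; [exists (dot c w), w|exact: wmin].
by apply: ge_inf; [exists (dot c w) => _ [v Sv <-]; exact: wmin|exists w].
Qed.

Lemma worst_cost_attained S chat c : S !=set0 -> compact S ->
  exists2 w, argmin_cost S chat w &
    (forall v, argmin_cost S chat v -> dot c v <= dot c w) /\
    spo_loss S chat c = dot c w - opt_cost S c.
Proof.
move=> S0 cS; have W0 := argmin_cost_neq0 chat S0 cS.
have cW : compact (argmin_cost S chat).
  have -> : argmin_cost S chat =
      S `&` dot chat @^-1` [set x | x <= opt_cost S chat].
    apply/seteqP; split=> w.
      by move=> Ww; split; [case: Ww|rewrite /= (argmin_costP Ww)].
    move=> [Sw /= wle]; split=> // v Sv; apply: (le_trans wle).
    have [u Wu] := W0; rewrite -(argmin_costP Wu); case: Wu => _; exact.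
  apply: compact_closedI => //; apply: preimage_closed; last exact: closed_le.
  by move=> w _; apply: continuous_dot.
have [|w] := @compact_EVT_max _ _ (dot c) _ W0 cW.
  exact/continuous_subspaceT/continuous_dot.
rewrite inE => Ww wmax'.
have wmax v : argmin_cost S chat v -> dot c v <= dot c w.
  by move=> Wv; apply: wmax'; rewrite inE.
exists w => //; split=> //; rewrite /spo_loss; congr (_ - _).
apply/eqP; rewrite eq_le; apply/andP; split.
  by apply: ge_sup => [|_ [v Wv <-]]; [exists (dot c w), w|exact: wmax].
by apply: ub_le_sup; [exists (dot c w) => _ [v Wv <-]; exact: wmax|exists w].
Qed.

End attained.

(* Main.v *)
(* The smallest value of the risk is z^*(cbar) - E z^*(c).  For every w in
   W^*(chat) the risk of chat is at least cbar^T w - E z^*(c), with equality when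
   W^*(chat) = {w}.  This settles the converse part.  For the direct part one
   needs singletons W^*(chat) = {w} with cbar^T w arbitrarily close to z^*(cbar);
   they are found as in Straszewicz's theorem, by taking for w a point of S
   farthest from t cbar with t large. *)
Require Import Defs.
From mathcomp Require Import all_boot all_order all_algebra.
From mathcomp Require Import all_classical all_reals all_analysis.
From mathcomp Require Import measurable_realfun ring lra.
Import Order.TTheory GRing.Theory Num.Theory.
Import numFieldNormedType.Exports.
Local Open Scope classical_set_scope.
Local Open Scope ring_scope.

(** * Inner product and exposed points close to optimal *)

Section dot.
Context {R : realType} {d : nat}.
Implicit Types (u v w : 'cV[R]_d) (S : set 'cV[R]_d).

Lemma dotC u v : dot u v = dot v u.
Proof. by rewrite !dotE; apply: eq_bigr => i _; rewrite mulrC. Qed.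

Lemma dotDl u v w : dot (u + v) w = dot u w + dot v w.
Proof. by rewrite !dotE -big_split; apply: eq_bigr => i _; rewrite !mxE mulrDl. Qed.

Lemma dotZl k v w : dot (k *: v) w = k * dot v w.
Proof. by rewrite !dotE mulr_sumr; apply: eq_bigr => i _; rewrite !mxE mulrA. Qed.

Lemma dotNl v w : dot (- v) w = - dot v w.
Proof. by rewrite -scaleN1r dotZl mulN1r. Qed.

Lemma coord_sqr_le_dot v i : v i 0 ^+ 2 <= dot v v.
Proof.
rewrite dotE (bigD1 i)//= -expr2 lerDl.
by apply: sumr_ge0 => j _; rewrite -expr2 sqr_ge0.
Qed.

Lemma dot_ge0 v : 0 <= dot v v.
Proof. by rewrite dotE; apply: sumr_ge0 => j _; rewrite -expr2 sqr_ge0. Qed.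

Lemma dot_le0_eq0 v : dot v v <= 0 -> v = 0.
Proof.
move=> v0; apply/matrixP => i j; rewrite ord1 mxE.
apply/eqP; rewrite -sqrf_eq0 eq_le sqr_ge0 andbT.
exact: le_trans (coord_sqr_le_dot v i) v0.
Qed.

Lemma norm_coord_le_euclidean v i : `|v i 0| <= euclidean_norm v.
Proof.
by rewrite /euclidean_norm -sqrtr_sqr ler_wsqrtr// coord_sqr_le_dot.
Qed.

Lemma continuous_dot_diag : continuous (fun v => dot v v).
Proof.
rewrite (_ : (fun v => dot v v) = fun v => \sum_i v i 0 * v i 0); last first.
  by apply/funext => v; rewrite dotE.
apply: continuous_big => [|i _ v]; first exact: add_continuous.
have cv : continuous (fun w : 'cV[R]_d => w i 0) by exact: coord_continuous.
exact: (continuousM (cv v) (cv v)).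
Qed.

Lemma continuous_euclidean_norm : continuous (@euclidean_norm R d).
Proof.
move=> v; apply: (@continuous_comp _ _ _ (fun v => dot v v) Num.sqrt).
  exact: continuous_dot_diag.
exact: sqrt_continuous.
Qed.

(** This bound is used twice: to choose how far away the point [a] must lie, and to dominate the
    optimal cost by an integrable function. *)
Lemma compact_dot_diag_bounded {S} : S !=set0 -> compact S ->
  exists B, forall v, S v -> dot v v <= B.
Proof.
move=> S0 cS; have [|w _ wmax] := @compact_EVT_max _ _ (fun v => dot v v) S S0 cS.
  exact/continuous_subspaceT/continuous_dot_diag.
by exists (dot w w) => v Sv; apply: wmax; rewrite inE.
Qed.

(* [k *: cbar - 2 *: w] is [2 (a - w)] for [w] farthest from [a = (k / 2) cbar]:
   expanding [|v - a|^2 <= |w - a|^2] gives [|v - w|^2 <= chat^T (v - w)]. *)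
Lemma exposed_near_argmin {S} (cbar : 'cV[R]_d) {e} :
    S !=set0 -> compact S -> 0 < e ->
  exists chat w, argmin_cost S chat = [set w] /\
    forall v, S v -> dot cbar w <= dot cbar v + e.
Proof.
move=> S0 cS e0; have [B SB] := compact_dot_diag_bounded S0 cS.
have B0 : 0 <= B by case: (S0) => x /SB; apply: le_trans; exact: dot_ge0.
(* Maximality of [w] gives [k * (dot cbar w - dot cbar v) <= dot w w - dot v v <= B], so the error
   is at most [e] once [B <= k * e]. The summand 1 keeps [k] positive when [B = 0]. *)
pose k := B / e + 1.
have k0 : 0 < k by rewrite ltr_wpDl// divr_ge0// ltW.
have keB : B <= k * e by rewrite mulrDl mul1r divfK ?gt_eqF// lerDl ltW.
have [|w Sw wmax] :=
    @compact_EVT_max _ _ (fun v => dot v v - k * dot cbar v) S S0 cS.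
  apply: continuous_subspaceT => v.
  exact: (continuousB (continuous_dot_diag v)
    (continuousM (@cst_continuous _ _ k v) (@continuous_dot _ _ cbar v))).
rewrite inE in Sw.
have far v : S v -> dot v v - k * dot cbar v <= dot w w - k * dot cbar w.
  by move=> Sv; apply: wmax; rewrite inE.
exists (k *: cbar - 2 *: w), w; split; last first.
  move=> v Sv; rewrite -(ler_pM2l k0) mulrDr.
  have := far v Sv; have := SB w Sw; have := dot_ge0 v; lra.
have gap v : S v ->
    dot (k *: cbar - 2 *: w) w + dot (v - w) (v - w) <=
    dot (k *: cbar - 2 *: w) v.
  move=> /far; rewrite !(dotDl, dotNl, dotZl).
  rewrite (dotC v (v - w)) (dotC w (v - w)) !(dotDl, dotNl) (dotC w v); lra.
apply/seteqP; split=> [v [Sv vmin]|_ ->] /=.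
  apply/eqP; rewrite -subr_eq0; apply/eqP/dot_le0_eq0.
  by have := gap v Sv; have := vmin w Sw; lra.
by split=> // v /gap; apply: le_trans; rewrite lerDl dot_ge0.
Qed.

End dot.

(** * Measurability of the optimal cost and of the loss *)

Section risk.
Context {R : realType} {d : nat} {disp : measure_display}
  {T : measurableType disp} (P : probability T R) (c : T -> 'cV[R]_d)
  (S : set 'cV[R]_d).
Hypotheses (S_neq0 : S !=set0) (S_compact : compact S)
  (c_random : random_vector c)
  (c_integrable : ('E_P[fun t => euclidean_norm (c t)] < +oo)%E).

Let measurable_preimage_open (U : set 'cV[R]_d) :
  open U -> measurable (c @^-1` U).
Proof.
move=> oU; rewrite -[X in measurable X]setTI.
by apply: c_random => //; exact: sub_sigma_algebra.
Qed.

Let measurable_continuous (f : 'cV[R]_d -> R) :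
  continuous f -> measurable_fun setT (f \o c).
Proof.
move=> cf; apply: (measurability _ (RGenOInfty.measurableE R)).
move=> _ [_ [r ->] <-]; rewrite setTI comp_preimage.
by apply: measurable_preimage_open; move/continuousP: cf; apply.
Qed.

(** Since the maximum is attained, [r < f t] holds exactly when [c t] lies in one of the open
    half-spaces [r < dot w _] with [w] in [A]. Their union is open even for uncountable [A], so its
    preimage under [c] is measurable. *)
Let measurable_max_dot (A : set 'cV[R]_d) (f : T -> R) :
    (forall t, exists2 w, A w &
       (forall v, A v -> dot (c t) v <= dot (c t) w) /\ f t = dot (c t) w) ->
  measurable_fun setT f.
Proof.
move=> fmax; apply: (measurability _ (RGenOInfty.measurableE R)).
move=> _ [_ [r ->] <-]; rewrite setTI.
rewrite (_ : _ @^-1` _ =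
    c @^-1` \bigcup_(w in A) dot w @^-1` [set x | r < x]).
  apply: measurable_preimage_open; apply: bigcup_open => w _.
  by apply: open_comp; [move=> u _; exact: continuous_dot|exact: open_gt].
apply/seteqP; split=> t; have [w Aw [wmax ft]] := fmax t;
  rewrite /= in_itv/= andbT ft.
  by move=> rw; exists w => //=; rewrite dotC.
by case=> v Av /=; rewrite dotC => /lt_le_trans; apply; exact: wmax.
Qed.

Let measurable_opt_cost : measurable_fun setT (fun t => opt_cost S (c t)).
Proof.
rewrite (_ : (fun t => _) = -%R \o (fun t => - opt_cost S (c t))); last first.
  by apply/funext => t /=; rewrite opprK.
apply: measurableT_comp => //.
(* The minimum over [S] is minus a maximum over the reflected set [-S]. *)
apply: (@measurable_max_dot [set - w | w in S]) => t.
have [w Ww] := argmin_cost_neq0 (c t) S_neq0 S_compact.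
exists (- w); first by exists w => //; case: Ww.
split; last by rewrite dotC dotNl dotC (argmin_costP Ww).
by move=> _ [v Sv <-]; rewrite !(dotC (c t)) !dotNl lerN2 !(dotC _ (c t)); apply Ww.
Qed.

Let measurable_spo_loss chat :
  measurable_fun setT (fun t => spo_loss S chat (c t)).
Proof.
(* Adding back the optimal cost leaves the pure maximum over [argmin_cost S chat]. *)
rewrite (_ : (fun t => _) = (fun t => spo_loss S chat (c t) + opt_cost S (c t))
    \- (fun t => opt_cost S (c t))); last by apply/funext => t /=; rewrite addrK.
apply: measurable_funB => //; apply: (@measurable_max_dot (argmin_cost S chat)) => t.
have [w Ww [wmax ->]] := worst_cost_attained chat (c t) S_neq0 S_compact.
by exists w => //; rewrite subrK.
Qed.

(** * Integrability of costs and the role of the mean vector *)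

Let integrable_euclidean_norm :
  P.-integrable setT (EFin \o (fun t => euclidean_norm (c t))).
Proof.
apply/integrableP; split.
  exact/measurable_EFinP/measurable_continuous/continuous_euclidean_norm.
move: c_integrable; rewrite unlock; congr (_ < _)%E.
by apply: eq_integral => t _ /=; rewrite ger0_norm// sqrtr_ge0.
Qed.

Let integrable_coord i : P.-integrable setT (EFin \o (fun t => c t i 0)).
Proof.
apply: le_integrable integrable_euclidean_norm => //.
  apply/measurable_EFinP/(@measurable_continuous (fun v => v i 0)).
  exact: coord_continuous.
move=> t _ /=; rewrite lee_fin (@ger0_norm _ (euclidean_norm _)) ?sqrtr_ge0//.
exact: norm_coord_le_euclidean.
Qed.

Let integrable_dot w : P.-integrable setT (EFin \o (fun t => dot (c t) w)).
Proof.
rewrite (_ : _ \o _ = fun t => (\sum_i (c t i 0)%:E * (w i 0)%:E)%E); last first.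
  by apply/funext => t /=; rewrite dotE -sumEFin.
by apply: integrable_sum => // i _; exact: (integrableZr _ (w i 0) (integrable_coord i)).
Qed.

Let integral_dot w :
  (\int[P]_t (dot (c t) w)%:E = (dot (mean_vector P c) w)%:E)%E.
Proof.
transitivity (\int[P]_t (\sum_i (c t i 0)%:E * (w i 0)%:E))%E.
  by apply: eq_integral => t _; rewrite dotE -sumEFin.
rewrite integral_sum//; last by move=> i; exact: (integrableZr _ (w i 0) (integrable_coord i)).
rewrite dotE -sumEFin; apply: eq_bigr => i _.
(* Integrability of the coordinates makes their expectations finite, so [fine] in [mean_vector]
   returns the true value and not its default. *)
rewrite /mean_vector mxE unlock EFinM fineK.
  exact: (integralZr _ (integrable_coord i)).
exact: (integrable_fin_num _ (integrable_coord i)).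
Qed.

Let integrable_opt_cost :
  P.-integrable setT (EFin \o (fun t => opt_cost S (c t))).
Proof.
have [B SB] := compact_dot_diag_bounded S_neq0 S_compact.
(* Every [w] in [S] has [w i 0 ^+ 2 <= B], hence its coordinates are at most [1 + B] in absolute
   value, a bound free of square roots. *)
pose g t := \sum_i `|c t i 0| * (1 + B).
have ig : P.-integrable setT (EFin \o g).
  rewrite (_ : _ \o _ = fun t => (\sum_i `|(c t i 0)%:E| * (1 + B)%:E)%E).
    apply: integrable_sum => // i _; apply: integrableZr => //.
    exact: integrable_abse (integrable_coord i).
  by apply/funext => t /=; rewrite -sumEFin.
apply: le_integrable ig => //; first exact/measurable_EFinP.
move=> t _ /=; rewrite lee_fin; apply: le_trans (ler_norm _).
have [w Ww] := argmin_cost_neq0 (c t) S_neq0 S_compact.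
rewrite -(argmin_costP Ww) dotE; apply: le_trans (ler_norm_sum _ _ _) _.
apply: ler_sum => i _; rewrite normrM ler_wpM2l//.
have : w i 0 ^+ 2 <= B by apply: le_trans (coord_sqr_le_dot w i) (SB w _); case: Ww.
rewrite -real_normK ?num_real//; nra.
Qed.

(** * Risk up to a common finite offset, and the two implications *)

Let risk_offset : R := \int[P]_t opt_cost S (c t).

Let expectation_excess_cost w :
  ('E_P[fun t => (dot (c t) w - opt_cost S (c t))%R] =
   (dot (mean_vector P c) w - risk_offset)%R%:E)%E.
Proof.
rewrite unlock; under eq_integral do rewrite EFinB.
rewrite (integralB _ (integrable_dot w) integrable_opt_cost)// integral_dot EFinB.
by congr (_ - _)%E; rewrite /risk_offset /Rintegral fineK// integrable_fin_num.
Qed.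

Lemma spo_risk_ge {chat w} : argmin_cost S chat w ->
  ((dot (mean_vector P c) w - risk_offset)%R%:E <= spo_risk P c S chat)%E.
Proof.
move=> Ww; rewrite -expectation_excess_cost /spo_risk unlock.
(* With nonnegative integrands, monotonicity of the integral asks only for measurability of the
   loss. *)
have excess_ge0 t : 0 <= dot (c t) w - opt_cost S (c t).
  have [v Wv] := argmin_cost_neq0 (c t) S_neq0 S_compact.
  by rewrite -(argmin_costP Wv) subr_ge0; case: Wv => _; apply; case: Ww.
have excess_le t : dot (c t) w - opt_cost S (c t) <= spo_loss S chat (c t).
  have [v _ [vmax ->]] := worst_cost_attained chat (c t) S_neq0 S_compact.
  by rewrite lerB// vmax.
apply: ge0_le_integral => //.
- by move=> t _; rewrite lee_fin.
- apply/measurable_EFinP/measurable_funB => //.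
  by apply/measurable_EFinP; exact: measurable_int (integrable_dot w).
- exact/measurable_EFinP.
- by move=> t _; rewrite lee_fin.
Qed.

Lemma spo_risk_singleton {chat w} : argmin_cost S chat = [set w] ->
  spo_risk P c S chat = (dot (mean_vector P c) w - risk_offset)%R%:E.
Proof.
move=> Ww; rewrite -expectation_excess_cost /spo_risk; congr expectation.
by apply/funext => t; rewrite /spo_loss Ww image_set1 sup1.
Qed.

(** The competitor is a [chat] with a single optimal point [u] that is within [e] of optimal for the
    mean. The lower bound at [cstar] and the exact risk at [chat] share the offset, so [w] costs no
    more than [u] under the mean; then [e] tends to 0. *)
Lemma minimizer_argmin_sub cstar : spo_risk_minimizer P c S cstar ->
  argmin_cost S cstar `<=` argmin_cost S (mean_vector P c).
Proof.
move=> cmin w Ww; split; first by case: Ww.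
move=> v Sv; apply/ler_addgt0Pr => e e0.
have [chat [u [Wu ule]]] :=
  exposed_near_argmin (mean_vector P c) S_neq0 S_compact e0.
apply: le_trans (ule v Sv).
have := le_trans (spo_risk_ge Ww) (cmin chat).
by rewrite (spo_risk_singleton Wu) lee_fin lerD2r.
Qed.

(** The risk of [cstar] is exactly the mean cost of [w] minus the offset. Any [chat] has some
    optimal [u] in [S], which bounds its risk below by the mean cost of [u] minus the same offset,
    and [w] is optimal for the mean. *)
Lemma singleton_argmin_sub_minimizer cstar w : argmin_cost S cstar = [set w] ->
  argmin_cost S cstar `<=` argmin_cost S (mean_vector P c) ->
  spo_risk_minimizer P c S cstar.
Proof.
move=> Ww; rewrite Ww => /(_ w erefl)[_ wmin] chat.
have [u Wu] := argmin_cost_neq0 chat S_neq0 S_compact.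
rewrite (spo_risk_singleton Ww); apply: le_trans (spo_risk_ge Wu).
by rewrite lee_fin lerD2r wmin//; case: Wu.
Qed.

End risk.

Theorem proposition5 (R : realType) (d : nat)
    (disp : measure_display) (T : measurableType disp) (P : probability T R)
    (S : set 'cV[R]_d) (c : T -> 'cV[R]_d)
    (S_neq0 : S !=set0) (S_compact : compact S) (S_convex : convex_set S)
    (c_random : random_vector c)
    (c_integrable : ('E_P[fun t => euclidean_norm (c t)] < +oo)%E) :
  (forall cstar : 'cV[R]_d,
     spo_risk_minimizer P c S cstar ->
     argmin_cost S cstar `<=` argmin_cost S (mean_vector P c)) /\
  (forall cstar : 'cV[R]_d,
     (exists w : 'cV[R]_d, argmin_cost S cstar = [set w]) ->
     argmin_cost S cstar `<=` argmin_cost S (mean_vector P c) ->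
     spo_risk_minimizer P c S cstar).
Proof.
split=> cstar; first exact: minimizer_argmin_sub.
by move=> [w Ww]; exact: singleton_argmin_sub_minimizer Ww.
Qed.
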